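(* Let $B\subset\mathbb R^{n+1}$ be the spectral scale of $b_1,\dots,b_n$, and let $q^-\le q^+$ be projections in $N$ such that $F=\Psi([q^-,q^+])$ is a face of $B$. Suppose there are spectral pairs $(s_1,\mathbf t_1),\dots,(s_n,\mathbf t_n)$ such that (1) $F\subset\Psi([p_{s_i,\mathbf t_i}^-,p_{s_i,\mathbf t_i}^+])$ for $i=1,\dots,n$, and (2) $\mathbf t_1,\dots,\mathbf t_n$ are linearly independent. Then $q^-$ and $q^+$ are central projections in the von Neumann algebra generated by $\{b_1,\dots,b_n\}$.
   Context: $M$ is a finite von Neumann algebra with a faithful normal tracial state $\tau$, $n$ is a positive integer, and $b_1,\dots,b_n\in M$ are self-adjoint; $N$ is the von Neumann subalgebra of $M$ generated by $b_1,\dots,b_n$ and $1$. $M_1^+=\{a\in M:0\le a\le 1\}$, $\Psi(a)=(\tau(a),\tau(b_1a),\dots,\tau(b_na))$, and $B=\Psi(M_1^+)$ is the spectral scale, a compact convex set. For projections $p\le q$ in $M$, $[p,q]=\{a\in M_1^+:p\le a\le q\}$. (Every face of $B$ is of the form $\Psi([q^-,q^+])$ with $q^-\le q^+$ projections in $N$.) For nonzero $\mathbf t\in\mathbb R^n$, $b_{\mathbf t}=t_1b_1+\cdots+t_nb_n$. A spectral pair is a pair $(s,\mathbf t)$ with $s\in\mathbb R$ and $\mathbf t\in\mathbb R^n$ nonzero; $p_{s,\mathbf t}^+$ and $p_{s,\mathbf t}^-$ are the spectral projections of $b_{\mathbf t}$ for $(-\infty,s]$ and $(-\infty,s)$. The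 von Neumann algebra generated by $\{b_1,\dots,b_n\}$ contains the identity of $M$, i.e. it is $N$. *)

(* Defs.v *)
From HB Require Import structures.
From mathcomp Require Import all_boot all_order all_algebra.
From mathcomp Require Import sesquilinear complex.
From mathcomp Require Import all_classical all_reals all_analysis.

Set Implicit Arguments.
Unset Strict Implicit.
Unset Printing Implicit Defensive.

Import Order.TTheory GRing.Theory Num.Theory.
Import numFieldNormedType.Exports.

Local Open Scope classical_set_scope.
Local Open Scope ring_scope.
Local Open Scope complex_scope.

Section Operators.
Context {R : realType} {H : completeNormedModType R[i]}.

(* The inner product is linear in its first argument. *)
Variable dot : {dot H for (@Num.conj R[i])}.

Definition hilbert_norm := forall x : H, `|x| ^+ 2 = dot x x.

Implicit Types (a b p q : H -> H) (A S : set (H -> H)).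

Definition bounded_op : set (H -> H) :=
  [set a | linear a /\ continuous a].

Definition adjoint a b := forall x y : H, dot (a x) y = dot x (b y).

Definition self_adjoint a := adjoint a a.

(* The order of R[i] is partial: [0 <= z] says that z is real and
   nonnegative. *)
Definition op_le a b := forall x : H, 0 <= dot (b x - a x) x.

Definition projection p := [/\ bounded_op p, p \o p = p & self_adjoint p].

Definition commutant S : set (H -> H) :=
  [set a | bounded_op a /\ forall s, S s -> a \o s = s \o a].

(* A self-adjoint set of operators equal to its bicommutant; being a commutant,
   it is a unital subalgebra of the bounded operators. *)
Definition von_neumann A :=
  (forall a b, A a -> adjoint a b -> A b) /\ commutant (commutant A) = A.

Definition vn_generated S : set (H -> H) := smallest von_neumann S.

(* Every isometry is unitary. *)
Definition finite_von_neumann A :=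
  von_neumann A /\
  forall v w, A v -> adjoint v w -> w \o v = idfun -> v \o w = idfun.

Definition central_projection A p := projection p /\ (A `&` commutant A) p.

Section Trace.
Variables (M : set (H -> H)) (tau : (H -> H) -> R[i]).

Definition state := [/\
  forall (k : R[i]) a b, M a -> M b ->
    tau (fun x => k *: a x + b x) = k * tau a + tau b,
  forall a, M a -> op_le (cst 0) a -> 0 <= tau a
  & tau idfun = 1].

Definition tracial := forall a b, M a -> M b -> tau (a \o b) = tau (b \o a).

Definition faithful :=
  forall a, M a -> op_le (cst 0) a -> tau a = 0 -> a = cst 0.

Let Msa := M `&` self_adjoint.

(* tau preserves suprema of bounded upward directed families. *)
Definition normal := forall (D : set (H -> H)) a,
  D !=set0 -> D `<=` Msa ->
  (forall c d, D c -> D d -> exists2 e, D e & op_le c e /\ op_le d e) ->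
  Msa a -> (forall d, D d -> op_le d a) ->
  (forall c, Msa c -> (forall d, D d -> op_le d c) -> op_le a c) ->
  complex.Re (tau a) = sup [set complex.Re (tau d) | d in D].

Definition unit_ball_pos : set (H -> H) :=
  [set a | [/\ M a, op_le (cst 0) a & op_le a idfun]].

Definition op_itv p q : set (H -> H) :=
  [set a | [/\ unit_ball_pos a, op_le p a & op_le a q]].

Variables (n : nat) (b : 'I_n -> H -> H).

(* On positive a in M the values of tau below are real when tau is a tracial
   state and the b i are self-adjoint elements of M. *)
Definition Psi a : 'rV[R]_(1 + n) :=
  row_mx (\row__ complex.Re (tau a)) (\row_i complex.Re (tau (b i \o a))).

Definition spectral_scale : set 'rV[R]_(1 + n) := Psi @` unit_ball_pos.

End Trace.

Definition op_comb n (b : 'I_n -> H -> H) (t : 'rV[R]_n) : H -> H :=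
  fun x => \sum_i (t ord0 i)%:C *: b i x.

(* E is the projection-valued measure on the Borel sets of R such that
   a = \int l dE(l), the integral being taken weakly. *)
Record spectral_measure a (E : set (measurableTypeR R) -> H -> H) : Prop := {
  spectral_measure_proj : forall A : set (measurableTypeR R), measurable A -> projection (E A) ;
  spectral_measureT : E setT = idfun ;
  spectral_measureI : forall A B : set (measurableTypeR R), measurable A -> measurable B ->
    E (A `&` B) = E A \o E B ;
  spectral_measure_sigma : forall F : nat -> set (measurableTypeR R),
    (forall k, measurable (F k)) -> trivIset setT F -> forall x : H,
    series (fun k => E (F k) x) @ \oo --> E (\bigcup_k F k) x ;
  spectral_measure_bounded : exists r : R, E `[- r, r]%classic = idfun ;
  spectral_measure_int : forall x : H,
    exists mu : {finite_measure set (measurableTypeR R) -> \bar R},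
      (forall A : set (measurableTypeR R), measurable A -> dot (E A x) x = (fine (mu A))%:C) /\
      dot (a x) x = (\int[mu]_(l in setT) (l : R))%R%:C
}.

End Operators.

Definition is_face (R : realType) (V : lmodType R) (B F : set V) :=
  [/\ F `<=` B, convex_set (F : set (convex_lmodType V)) &
    forall (x y : V) (l : R), B x -> B y -> 0 < l -> l < 1 ->
      F (l *: x + (1 - l) *: y) -> F x /\ F y].

(* Main.v *)
Require Import Defs.
From HB Require Import structures.
From mathcomp Require Import all_boot all_order all_algebra.
From mathcomp Require Import sesquilinear complex.
From mathcomp Require Import ring.
From mathcomp Require Import all_classical all_reals all_analysis.
From mathcomp Require Import measurable_realfun.

Set Implicit Arguments.
Unset Strict Implicit.
Unset Printing Implicit Defensive.

Import Order.TTheory GRing.Theory Num.Theory.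
Import numFieldNormedType.Exports.

Local Open Scope classical_set_scope.
Local Open Scope ring_scope.

(** Fix one of the pairs (s, t), put c = b_t - s, and let p-, p+ be the
    spectral projections of b_t for ]-oo, s[ and ]-oo, s]. The functional
    f |-> Re (tau (c f)) factors through Psi, and on the positive part of the unit
    ball of M it attains its minimum, the trace of minus the negative part of
    c, exactly on the order interval [p-, p+]. Both q- and q+ lie in [q-, q+],
    so by hypothesis the value of Psi at each of them is the value at some d
    in [p-, p+]; hence q- and q+ are minimizers. A projection q minimizing the
    functional commutes with c: the equality case, obtained from faithfulness
    of the trace, says that the positive part of c vanishes on the range of q
    and the negative part on its kernel.

    The spectral projections of b_t are not known to lie in M from their
    definition, so that the trace cannot be applied to them. This is
    circumvented by writing minus the negative part of c as c d, where d lies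
    in M: see [spectral_op_itv] for the identity behind this and
    [proj_commute] for the equality case; [Psi_commute] combines them.

    Thus q- and q+ commute with b_t for each of the n vectors t. These vectors
    form a basis, so q- and q+ commute with every b_i ([commute_basis]), and
    therefore with the von Neumann algebra generated by the b_i, in which they
    lie ([central_vn_generated]). *)

(** * Linear operators and commutants *)

Section Linear.
Context {R : realType} {H : completeNormedModType R[i]}.
Implicit Types (a b : H -> H) (S : set (H -> H)) (x y : H) (k : R[i]).

Lemma linearD_op a x y : linear a -> a (x + y) = a x + a y.
Proof. by move=> al; have := al 1 x y; rewrite !scale1r. Qed.

Lemma linear0_op a : linear a -> a 0 = 0.
Proof.
by move=> al; apply: (@addrI _ (a 0)); rewrite -(linearD_op 0 0 al) !addr0.
Qed.

Lemma linearZ_op a k x : linear a -> a (k *: x) = k *: a x.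
Proof. by move=> al; have := al k x 0; rewrite (linear0_op al) !addr0. Qed.

Lemma linearB_op a x y : linear a -> a (x - y) = a x - a y.
Proof.
by move=> al; rewrite linearD_op// -scaleN1r linearZ_op// scaleN1r.
Qed.

Lemma bounded_comp a b : bounded_op a -> bounded_op b -> bounded_op (a \o b).
Proof.
move=> [al ac] [bl bc]; split; first by move=> k x y /=; rewrite bl al.
by move=> x; apply: continuous_comp; [exact: bc|exact: ac].
Qed.

Lemma bounded_lincomb k a b :
  bounded_op a -> bounded_op b -> bounded_op (fun x => k *: a x + b x).
Proof.
move=> [al ac] [bl bc]; split.
  move=> l x y /=; rewrite al bl !scalerDr !scalerA (mulrC k l) -!addrA.
  by congr (_ + _); rewrite addrCA.
by move=> x; apply: cvgD; [apply: cvgZl_tmp; exact: ac|exact: bc].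
Qed.

Lemma bounded_id : bounded_op (idfun : H -> H).
Proof. by split=> // x; exact: cvg_id. Qed.

Lemma commutant_comp S a b :
  commutant S a -> commutant S b -> commutant S (a \o b).
Proof.
move=> [ab ac] [bb bc]; split; first exact: bounded_comp.
by move=> s Ss; rewrite -compA (bc s Ss) compA (ac s Ss).
Qed.

Lemma commutant_lincomb S k a b : (forall s, S s -> linear s) ->
  commutant S a -> commutant S b -> commutant S (fun x => k *: a x + b x).
Proof.
move=> Sl [ab ac] [bb bc]; split; first exact: bounded_lincomb.
move=> s Ss; apply/funext => x /=; rewrite (Sl s Ss).
by have /funeqP/(_ x)/= -> := ac s Ss; have /funeqP/(_ x)/= -> := bc s Ss.
Qed.

Lemma commutant_id S : commutant S idfun.
Proof. by split=> //; exact: bounded_id. Qed.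

Lemma commutantS S S' : S `<=` S' -> commutant S' `<=` commutant S.
Proof. by move=> SS a [ab ac]; split=> // s /SS; exact: ac. Qed.

Lemma sub_bicommutant S : S `<=` bounded_op -> S `<=` commutant (commutant S).
Proof. by move=> Sb a Sa; split=> [|s [_ /(_ a Sa)]]; first exact: Sb. Qed.

Lemma tricommutant S :
  S `<=` bounded_op -> commutant (commutant (commutant S)) = commutant S.
Proof.
move=> Sb; apply/seteqP; split; last by apply: sub_bicommutant => a [].
by apply: commutantS; exact: sub_bicommutant.
Qed.

End Linear.

(** * Quadratic forms of operators *)

Section Hilbert.
Context {R : realType} {H : completeNormedModType R[i]}.
Variable dot : {dot H for (@Num.conj R[i])}.
Implicit Types (a b p q : H -> H) (S : set (H -> H)) (x y : H).

Lemma dotC x y : dot x y = (dot y x)^*.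
Proof. by rewrite hermC expr0 mul1r. Qed.

Lemma dotDl x y z : dot (x + y) z = dot x z + dot y z.
Proof. exact: linearDl. Qed.

Lemma dotBl x y z : dot (x - y) z = dot x z - dot y z.
Proof. exact: linearBl. Qed.

Lemma dotZl k x z : dot (k *: x) z = k * dot x z.
Proof. exact: linearZl_LR. Qed.

Lemma dotDr x y z : dot x (y + z) = dot x y + dot x z.
Proof. exact: linearDr. Qed.

Lemma dotBr x y z : dot x (y - z) = dot x y - dot x z.
Proof. exact: linearBr. Qed.

Lemma dotZr k x z : dot x (k *: z) = k^* * dot x z.
Proof. exact: linearZr_LR. Qed.

Lemma dot0l x : dot 0 x = 0.
Proof. exact: linear0l. Qed.

Lemma dot_inj x y : (forall z, dot z x = dot z y) -> x = y.
Proof.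
by move=> xy; apply/eqP; rewrite -subr_eq0 -(dnorm_eq0 dot) dotBr subr_eq0 xy.
Qed.

Lemma op_ge0P a : op_le dot (cst 0) a <-> forall x, 0 <= dot (a x) x.
Proof. by split=> + x => /(_ x); rewrite /= subr0. Qed.

Lemma adjoint_linear a b : adjoint dot a b -> linear b.
Proof.
move=> ab k x y; apply: dot_inj => z.
by rewrite -ab !dotDr !dotZr -!ab.
Qed.

(** Polarization: that the form is real at x + y gives the imaginary part of
    the adjointness equation at (x, y), and at x + 'i y the real part. *)
Lemma self_adjointP a : linear a ->
  (forall x, dot (a x) x \is Num.real) -> self_adjoint dot a.
Proof.
move=> al ar x y.
have form_add u v : dot (a u) v + dot (a v) u = dot v (a u) + dot u (a v).
  have : dot (a (u + v)) (u + v) - dot (a u) u - dot (a v) v \is Num.real.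
    by rewrite !rpredB.
  have -> : dot (a (u + v)) (u + v) - dot (a u) u - dot (a v) v =
            dot (a u) v + dot (a v) u.
    by rewrite linearD_op// dotDl !dotDr; ring.
  by move=> /CrealP; rewrite rmorphD/= -!dotC => ->.
have e1 := form_add x y; have := form_add x ('i *: y).
rewrite linearZ_op// !dotZl !dotZr conjCi.
move=> e2; have i0 : 'i != 0 :> R[i] by exact: neq0Ci.
have {}e2 : dot (a y) x - dot (a x) y = dot y (a x) - dot x (a y).
  by apply: (mulfI i0); rewrite !mulrBr addrC -mulNr e2 mulNr.
have n0 : 2 != 0 :> R[i] by rewrite pnatr_eq0.
apply: (mulfI n0).
have -> : 2 * dot (a x) y =
  (dot (a x) y + dot (a y) x) - (dot (a y) x - dot (a x) y) by ring.
by rewrite e1 e2; ring.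
Qed.

(** The Cauchy-Schwarz argument for a positive form: a zero of the form is a
    minimum, so the derivative of the form at x in the direction a x vanishes,
    and this derivative is twice the square of the norm of a x. *)
Lemma form_eq0_ker a x : linear a -> (forall x, 0 <= dot (a x) x) ->
  dot (a x) x = 0 -> a x = 0.
Proof.
move=> al a_ge0 axx; apply/eqP; rewrite -(dnorm_eq0 dot); apply/eqP.
have a_sa : self_adjoint dot a.
  by apply: self_adjointP => // y; exact/ger0_real.
pose u := dot (a x) (a x); pose v := dot (a (a x)) (a x).
have u_ge0 : 0 <= u by exact: dnorm_ge0.
have v_ge0 : 0 <= v by exact: a_ge0.
have line (r : R[i]) : r \is Num.real -> 0 <= 2 * r * u + r ^+ 2 * v.
  move=> rr; have := a_ge0 (x + r *: a x).
  rewrite linearD_op// linearZ_op// dotDl !dotDr !dotZl !dotZr axx add0r.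
  rewrite (CrealP rr) (a_sa (a x) x) -/u -/v => h; rewrite [leRHS](_ : _ =
    r * u + (r * u + r * (r * v))) // ; ring.
have d_gt0 : 0 < v + 1 by rewrite ltr_wpDl.
(* The increment is negative at this r unless u = 0; adding 1 avoids a
   division by zero when v = 0. *)
have := line (- (u / (v + 1))).
have -> : 2 * - (u / (v + 1)) * u + (- (u / (v + 1))) ^+ 2 * v =
    - ((u / (v + 1)) ^+ 2 * (v + 2)) by field; exact: lt0r_neq0.
have v2_gt0 : 0 < v + 2 by rewrite ltr_wpDl.
rewrite rpredN rpredM ?ger0_real ?invr_ge0 ?(ltW d_gt0)// => /(_ isT).
rewrite oppr_ge0 (pmulr_lle0 _ v2_gt0) => h.
have : (u / (v + 1)) ^+ 2 == 0.
  by rewrite eq_le h exprn_ge0// divr_ge0// ltW.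
by rewrite sqrf_eq0 mulf_eq0 invr_eq0 (gt_eqF d_gt0) orbF => /eqP.
Qed.

(** Identities between operators are proved below by applying this to the
    difference of the two sides, since a spectral measure is only known
    through quadratic forms. *)
Lemma form0_op0 a : linear a -> (forall x, dot (a x) x = 0) ->
  forall x, a x = 0.
Proof. by move=> al a0 x; apply: form_eq0_ker => // y; rewrite a0. Qed.

Hypothesis hdot : hilbert_norm dot.

(** If K bounds a, then |b y|^2 = <a (b y), y> <= K |b y| |y|. The inequality
    is read off from 0 <= |a (b y) - K^2 y|^2, which needs neither a square
    root nor a case analysis on b y = 0. *)
Lemma adjoint_bounded a b : bounded_op a -> adjoint dot a b -> bounded_op b.
Proof.
move=> [al ac] ab; have bl := adjoint_linear ab; split=> //.
pose aL : {linear H -> H} := HB.pack a (GRing.isLinear.Build _ _ _ _ a al).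
pose bL : {linear H -> H} := HB.pack b (GRing.isLinear.Build _ _ _ _ b bl).
have /linear_boundedP aB : bounded_near aL (nbhs (0 : H)).
  exact/linear_bounded_continuous.
have [K K_gt0 aK] := pinfty_ex_gt0 aB.
have bK y : `|b y| <= K * `|y|.
  have Kr : K^* = K by apply/CrealP; exact/gtr0_real.
  rewrite -(@ler_pXn2r _ 2) ?nnegrE ?mulr_ge0 ?(ltW K_gt0)// exprMn !hdot.
  have := dnorm_ge0 dot (a (b y) - K ^+ 2 *: y).
  have byy : dot y (a (b y)) = dot (b y) (b y) by rewrite dotC ab -dotC.
  rewrite dotBl !dotBr !dotZl !dotZr rmorphXn/= Kr byy (ab (b y) y) => h.
  have h' : dot (a (b y)) (a (b y)) <= K ^+ 2 * dot (b y) (b y).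
    by rewrite -!hdot -exprMn ler_pXn2r ?nnegrE ?mulr_ge0 ?(ltW K_gt0).
  rewrite -(ler_pM2l (exprn_gt0 2 K_gt0)) -subr_ge0.
  have := addr_ge0 h (etrans (subr_ge0 _ _) h').
  by congr (0 <= _); ring.
apply: (linear_bounded_continuous bL).1; apply/linear_boundedP.
exists K; split; first exact: gtr0_real.
move=> r Kr y; apply: (le_trans (bK y)).
by rewrite ler_wpM2r// ltW.
Qed.

(** A commutant equals its own bicommutant by general nonsense; the analytic
    content is that an adjoint of a bounded operator is again bounded. *)
Lemma von_neumann_commutant S : S `<=` bounded_op ->
  (forall s, S s -> self_adjoint dot s) -> von_neumann dot (commutant S).
Proof.
move=> Sb Ssa; split; last exact: tricommutant.
move=> a b [ab ac] adj; split; first exact: adjoint_bounded adj.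
move=> s Ss; apply/funext => x /=; apply: dot_inj => z.
have /funeqP/(_ z)/= asE := ac s Ss.
by rewrite -adj -!(Ssa s Ss) -adj asE.
Qed.

(** If p x = x then the positive form of 1 - a vanishes at x, and if q x = 0
    then the positive form of a vanishes at x. Hence a fixes the range of p and
    kills the kernel of q; the two equations are the adjoints of these facts. *)
Lemma op_itv_projE a p q : linear a ->
  op_le dot (cst 0) a -> op_le dot a idfun ->
  projection dot p -> projection dot q -> op_le dot p a -> op_le dot a q ->
  forall x, p (a x) = p x /\ q (a x) = a x.
Proof.
move=> al /op_ge0P a_ge0 a_le1 [[pl _] pp p_sa] [[ql _] qq q_sa] pa aq.
have a_sa : self_adjoint dot a.
  by apply: self_adjointP => // y; exact/ger0_real.
have ap x : a (p x) = p x.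
  have ppx : p (p x) = p x by exact: (congr1 (fun f => f x) pp).
  apply/eqP; rewrite eq_sym -subr_eq0; apply/eqP.
  apply: (@form_eq0_ker (fun x => x - a x)).
  - by move=> k u v; rewrite al scalerBr opprD addrACA.
  - by move=> y; exact: a_le1.
  - apply/eqP; rewrite eq_le a_le1 andbT.
    by rewrite -oppr_ge0 -linearNl/= opprB -{2}ppx; exact: pa.
have aqE x : a x = a (q x).
  have qz0 : q (x - q x) = 0.
    have /(congr1 (fun f => f x))/= qqx := qq.
    by rewrite linearB_op// qqx subrr.
  apply/eqP; rewrite -subr_eq0 -linearB_op//; apply/eqP.
  apply: form_eq0_ker => //; apply/eqP; rewrite eq_le a_ge0 andbT.
  rewrite -oppr_ge0 -linearNl/= -[X in dot X _]add0r -[X in X - _]qz0.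
  exact: aq.
move=> x; split; apply: dot_inj => z.
- by rewrite -p_sa -a_sa ap p_sa.
- by rewrite -q_sa -a_sa -aqE a_sa.
Qed.

End Hilbert.

(** * Tracial states *)

Section Trace.
Context {R : realType} {H : completeNormedModType R[i]}.
Variable dot : {dot H for (@Num.conj R[i])}.
Variables (M : set (H -> H)) (tau : (H -> H) -> R[i]).
Hypotheses (hM : von_neumann dot M) (tau_state : state dot M tau).
Implicit Types (a b c q x : H -> H).

Lemma vn_bounded a : M a -> bounded_op a.
Proof. by rewrite -hM.2 => -[]. Qed.

Lemma vn_linear a : M a -> linear a.
Proof. by move=> /vn_bounded[]. Qed.

Lemma vn_id : M idfun.
Proof. by rewrite -hM.2; exact: commutant_id. Qed.

Lemma vn_comp a b : M a -> M b -> M (a \o b).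
Proof. by rewrite -hM.2; exact: commutant_comp. Qed.

Lemma vn_lincomb k a b : M a -> M b -> M (fun v => k *: a v + b v).
Proof. by rewrite -hM.2; apply: commutant_lincomb => s [[]]. Qed.

Lemma vn_sub a b : M a -> M b -> M (fun v => a v - b v).
Proof.
move=> Ma Mb; have := vn_lincomb (-1) Mb Ma.
by congr M; apply/funext => v; rewrite scaleN1r addrC.
Qed.

Lemma vn0 : M (cst 0).
Proof.
have := vn_sub vn_id vn_id.
by congr M; apply/funext => v; rewrite subrr.
Qed.

Lemma vnZ k a : M a -> M (fun v => k *: a v).
Proof.
move=> Ma; have := vn_lincomb k Ma vn0.
by congr M; apply/funext => v; rewrite addr0.
Qed.

Lemma traceB a b : M a -> M b -> tau (fun v => a v - b v) = tau a - tau b.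
Proof.
move=> Ma Mb; case: tau_state => tl _ _.
have := tl (-1) _ _ Mb Ma; rewrite mulN1r addrC => <-.
by congr tau; apply/funext => v; rewrite scaleN1r addrC.
Qed.

Lemma trace0 : tau (cst 0) = 0.
Proof.
rewrite -(subrr (tau idfun)) -traceB; [|exact: vn_id..].
by congr tau; apply/funext => v; rewrite subrr.
Qed.

Lemma traceZ k a : M a -> tau (fun v => k *: a v) = k * tau a.
Proof.
move=> Ma; case: tau_state => tl _ _.
rewrite -[RHS]addr0 -trace0 -(tl k _ _ Ma vn0).
by congr tau; apply/funext => v; rewrite addr0.
Qed.

Lemma trace_sum (I : Type) (r : seq I) (k : I -> R[i]) (f : I -> H -> H) :
  (forall i, M (f i)) ->
  M (fun v => \sum_(i <- r) k i *: f i v) /\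
  tau (fun v => \sum_(i <- r) k i *: f i v) = \sum_(i <- r) k i * tau (f i).
Proof.
move=> Mf; elim: r => [|i r [IHM IHtau]].
  rewrite big_nil (_ : (fun _ => _) = cst 0).
    by split; [exact: vn0|exact: trace0].
  by apply/funext => v; rewrite big_nil.
rewrite big_cons -IHtau; case: tau_state => tl _ _.
rewrite -tl// (_ : (fun v => \sum_(_ <- _ :: _) _) =
  fun v => k i *: f i v + \sum_(i <- r) k i *: f i v).
  by split=> //; exact: vn_lincomb.
by apply/funext => v; rewrite big_cons.
Qed.

Hypotheses (tau_tracial : tracial M tau) (tau_faithful : faithful dot M tau).

(** By traciality a q has the same trace as q a q, which is positive. If that
    trace is zero then q a q = 0 by faithfulness, so that the form of a vanishes
    on the range of q. *)
Lemma trace_mul_proj a q : M a -> op_le dot (cst 0) a ->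
  M q -> projection dot q ->
  0 <= tau (a \o q) /\ (tau (a \o q) = 0 -> forall v, a (q v) = 0).
Proof.
move=> Ma /op_ge0P a_ge0 Mq [_ qq q_sa].
have Maq : M (a \o q) by exact: vn_comp.
have -> : tau (a \o q) = tau (q \o (a \o q)).
  rewrite (tau_tracial Mq Maq); congr tau; apply/funext => v /=.
  by have /(congr1 (fun f => f v))/= -> := qq.
have qaq_ge0 : op_le dot (cst 0) (q \o (a \o q)).
  by apply/op_ge0P => v /=; rewrite q_sa.
have Mqaq : M (q \o (a \o q)) by exact: vn_comp.
case: tau_state => _ tau_ge0 _; split; first exact: tau_ge0.
move=> /(tau_faithful Mqaq qaq_ge0) qaq0 v.
apply: (form_eq0_ker (vn_linear Ma) a_ge0).
have /(congr1 (fun f => f v))/= qaqv := qaq0.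
by rewrite -q_sa qaqv dot0l.
Qed.

(** Think of x as minus the negative part of c, so that c - x is the positive
    part. Then c q - x is the sum of (c - x) q and (- x) (1 - q), both of
    nonnegative trace. If the traces of c q and x agree, both terms vanish by
    faithfulness, which gives c q = x q = x. Being equal to the self-adjoint
    operator x, the product c q of two self-adjoint operators is a commuting
    one. *)
Lemma proj_commute c x q : M c -> self_adjoint dot c -> M x ->
  (forall v, dot (x v) v <= 0) -> (forall v, 0 <= dot (c v - x v) v) ->
  M q -> projection dot q ->
  complex.Re (tau (c \o q)) = complex.Re (tau x) -> c \o q = q \o c.
Proof.
move=> Mc c_sa Mx x_le0 cx_ge0 Mq q_proj tauE.
have [[ql _] qq q_sa] := q_proj.
pose q' := fun v => v - q v.
have Mq' : M q' by exact: (vn_sub vn_id Mq).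
have q'_proj : projection dot q'.
  split; first exact: vn_bounded.
    apply/funext => v; rewrite /q' /= linearB_op//.
    by have /(congr1 (fun f => f v))/= -> := qq; rewrite subrr subr0.
  by move=> u v; rewrite /q' dotBl dotBr q_sa.
have cx0 : op_le dot (cst 0) (fun v => c v - x v) by exact/op_ge0P.
have x0 : op_le dot (cst 0) (fun v => cst 0 v - x v).
  by apply/op_ge0P => v; rewrite sub0r -scaleN1r dotZl mulN1r oppr_ge0.
have [t1 t1_0] := trace_mul_proj (vn_sub Mc Mx) cx0 Mq q_proj.
have [t2 t2_0] := trace_mul_proj (vn_sub vn0 Mx) x0 Mq' q'_proj.
have xl := vn_linear Mx.
have t12 : tau ((fun v => c v - x v) \o q) + tau ((fun v => cst 0 v - x v) \o q')
    = tau (c \o q) - tau x.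
  rewrite (traceB (vn_comp Mc Mq) (vn_comp Mx Mq)).
  rewrite (traceB vn0 (vn_comp Mx Mq')) trace0.
  have -> : x \o q' = fun v => x v - (x \o q) v.
    by apply/funext => v; rewrite /q' /= linearB_op.
  by rewrite (traceB Mx (vn_comp Mx Mq)); ring.
have t12_0 : tau (c \o q) - tau x = 0.
  have : 0 <= tau (c \o q) - tau x by rewrite -t12 addr_ge0.
  rewrite lecE => /andP[/eqP im0 _].
  by rewrite [LHS]complexE im0 raddfB/= tauE subrr mulr0 addr0.
have /eqP := t12; rewrite t12_0 paddr_eq0// => /andP[/eqP /t1_0 cq /eqP /t2_0 xq].
have xE v : x v = x (q v).
  apply/eqP; rewrite -subr_eq0 -linearB_op// -oppr_eq0; apply/eqP.
  by have := xq v; rewrite sub0r.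
have cqE v : c (q v) = x v by rewrite xE; apply/eqP; rewrite -subr_eq0 cq.
have x_sa : self_adjoint dot x.
  by apply: self_adjointP => // v; exact/ler0_real.
apply/funext => v; apply: (@dot_inj _ _ dot) => z /=.
by rewrite cqE -x_sa -cqE c_sa q_sa.
Qed.

End Trace.

(** * Integrals against measures with bounded support *)

Section Integral.
Context {R : realType}.
Implicit Types (mu : {finite_measure set (measurableTypeR R) -> \bar R})
  (A : set (measurableTypeR R)).

Lemma integrable_id_bounded mu A (lo hi : R) : measurable A ->
  A `<=` `[lo, hi]%classic ->
  mu.-integrable A (EFin \o (fun l : measurableTypeR R => l : R)).
Proof.
move=> mA Alohi; apply: measurable_bounded_integrable => //.
  by rewrite ltey_eq fin_num_measure.
exists (`|lo| + `|hi|); split; first exact: num_real.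
move=> r rlt l /Alohi; rewrite /= in_itv/= => /andP[lol lhi].
apply: le_trans (ltW rlt); rewrite ler_norml; apply/andP; split.
  apply: le_trans lol; rewrite opprD ler_wnDr ?oppr_le0//.
  by rewrite lerNl -normrN ler_norm.
by apply: (le_trans lhi); rewrite ler_wpDl// ler_norm.
Qed.

Lemma Rintegral_concentrated mu A : measurable A -> mu (~` A) = 0%E ->
  (\int[mu]_(l in setT) (l : R))%R = (\int[mu]_(l in A) (l : R))%R.
Proof.
move=> mA mu0; rewrite [RHS]Rintegral_mkcond; congr fine.
have mid : measurable_fun setT (fun l : measurableTypeR R => (l : R)).
  exact: measurable_id.
apply: ae_eq_integral => //.
  apply/measurable_EFinP/(measurable_restrictT _ _).1 => //.
exists (~` A); split => //; first exact: measurableC.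
by move=> l; apply: contra_not => Al _; rewrite patchE mem_set//.
Qed.

End Integral.

(** * Spectral measures *)

Section Spectral.
Local Open Scope complex_scope.
Context {R : realType} {H : completeNormedModType R[i]}.
Variable dot : {dot H for (@Num.conj R[i])}.
Variables (a : H -> H) (E : set (measurableTypeR R) -> H -> H).
Hypotheses (al : linear a) (aE : spectral_measure dot a E).
Implicit Types (A B : set (measurableTypeR R)) (x v : H).

Lemma spectral_linear A : measurable A -> linear (E A).
Proof. by move=> /(spectral_measure_proj aE)[[]]. Qed.

Lemma spectral_sa A : measurable A -> self_adjoint dot (E A).
Proof. by move=> /(spectral_measure_proj aE)[]. Qed.

Lemma spectral_interE A B x : measurable A -> measurable B ->
  E A (E B x) = E (A `&` B) x.
Proof. by move=> mA mB; rewrite (spectral_measureI aE). Qed.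

Lemma spectral_idem A x : measurable A -> E A (E A x) = E A x.
Proof. by move=> mA; rewrite spectral_interE// setIid. Qed.

(** Only countable additivity is part of the definition of a spectral measure.
    Rather than padding with empty sets, additivity is taken from the scalar
    measures. *)
Lemma spectralU A B x : measurable A -> measurable B -> A `&` B = set0 ->
  E (A `|` B) x = E A x + E B x.
Proof.
move=> mA mB AB0; have mAB : measurable (A `|` B) by exact: measurableU.
apply/eqP; rewrite -subr_eq0; apply/eqP.
apply: (@form0_op0 _ _ dot (fun x => E (A `|` B) x - (E A x + E B x))).
  move=> k u v; rewrite !spectral_linear//.
  by rewrite [X in _ - X]addrACA -scalerDr opprD addrACA -scalerBr.
move=> {}x; have [mu [muE _]] := spectral_measure_int aE x.
rewrite dotBl dotDl !muE// (measureU mu mA mB AB0) fineD ?fin_num_measure//.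
by rewrite rmorphD subrr.
Qed.

Lemma spectral_set0 x : E set0 x = 0.
Proof.
have := @spectralU set0 set0 x measurable0 measurable0 (setI0 _).
by rewrite setU0 => /eqP; rewrite -subr_eq0 opprD addrA subrr sub0r oppr_eq0 => /eqP.
Qed.

Lemma spectralC A x : measurable A -> E (~` A) x = x - E A x.
Proof.
move=> mA; have mAC := measurableC mA.
apply/eqP; rewrite eq_sym subr_eq addrC -spectralU ?setICr//.
by rewrite setUv (spectral_measureT aE).
Qed.

Definition scalar_spectral_measure x
    (mu : {finite_measure set (measurableTypeR R) -> \bar R}) :=
  (forall A, measurable A -> dot (E A x) x = (fine (mu A))%:C) /\
  dot (a x) x = (\int[mu]_(l in setT) (l : R))%R%:C.

Lemma spectral_concentrated A x mu : measurable A -> E A x = x ->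
  scalar_spectral_measure x mu -> mu (~` A) = 0%E.
Proof.
move=> mA Ax [muE _]; have mAC := measurableC mA.
rewrite -(fineK (fin_num_measure mu _ mAC)).
have := muE _ mAC; rewrite spectralC// Ax subrr dot0l.
by move=> /(congr1 (@complex.Re R))/= <-.
Qed.

Lemma spectral_support : exists r : R, forall x, E `[- r, r]%classic x = x.
Proof.
by have [r rE] := spectral_measure_bounded aE; exists r => x; rewrite rE.
Qed.

(** As E A commutes with every E B, the scalar measures of the two orthogonal
    components of x add up to the scalar measure of x; integrate the identity
    function, on a bounded interval carrying all three measures. *)
Lemma spectral_form_split A x : measurable A ->
  dot (a x) x = dot (a (E A x)) (E A x) + dot (a (E (~` A) x)) (E (~` A) x).
Proof.
move=> mA; have mAC := measurableC mA.
have [r rE] := spectral_support.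
have mI : measurable (`[- r, r]%classic : set (measurableTypeR R)).
  exact: measurable_itv.
have [m m_mu] := spectral_measure_int aE x.
have [m1 m1_mu] := spectral_measure_int aE (E A x).
have [m2 m2_mu] := spectral_measure_int aE (E (~` A) x).
rewrite m_mu.2 m1_mu.2 m2_mu.2 -rmorphD; congr (_%:C).
have conc y mu : scalar_spectral_measure y mu ->
    (\int[mu]_(l in setT) (l : R))%R = (\int[mu]_(l in `[(- r)%R, r]) (l : R))%R.
  move=> y_mu; apply: Rintegral_concentrated => //.
  exact: spectral_concentrated y_mu.
have int_id (mu : {finite_measure set (measurableTypeR R) -> \bar R}) :
    mu.-integrable `[- r, r]%classic (EFin \o (fun l : measurableTypeR R => l : R)).
  exact: (@integrable_id_bounded _ _ _ (- r) r).
rewrite (conc _ _ m_mu) (conc _ _ m1_mu) (conc _ _ m2_mu).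
rewrite -fineD; last 2 first.
- exact: (integrable_fin_num _ (int_id m1)).
- exact: (integrable_fin_num _ (int_id m2)).
rewrite -integral_measure_add//; last 2 first.
- exact: int_id.
- exact: int_id.
congr fine; apply: eq_measure_integral => B mB _.
transitivity (m1 B + m2 B)%E; last exact: esym (measure_addE m1 m2 B).
have finE (mu : {finite_measure set (measurableTypeR R) -> \bar R}) :
  mu B = (fine (mu B))%:E by rewrite fineK// fin_num_measure.
transitivity (fine (m B))%:E; first exact: finE.
transitivity ((fine (m1 B))%:E + (fine (m2 B))%:E)%E; last first.
  by congr (_ + _)%E; apply: esym; exact: finE.
rewrite -EFinD; congr EFin; apply: (@complexI R).
rewrite rmorphD/= -m_mu.1// -m1_mu.1// -m2_mu.1//.
rewrite -(spectral_sa mA) -(spectral_sa mAC) !spectral_interE//; last first.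
- exact: measurableI.
- exact: measurableI.
rewrite -dotDl -spectralU//; last 3 first.
- by apply: measurableI => //; exact: measurableI.
- by apply: measurableI => //; exact: measurableI.
- by apply/seteqP; split=> // l [[_ Al] [_]].
congr (dot (E _ x) x); apply/seteqP; split=> [l Bl|l [|] [[]]//].
by have [Al|Al] := pselect (A l); [left|right].
Qed.

(** Since the form of a splits along E A, it equals the form of the
    block-diagonal part of a; hence a is block-diagonal. *)
Lemma spectral_commute A x : measurable A -> a (E A x) = E A (a x).
Proof.
move=> mA; have mAC := measurableC mA.
have split0 y : a y = E A (a (E A y)) + E (~` A) (a (E (~` A) y)).
  apply/eqP; rewrite -subr_eq0; apply/eqP.
  apply: (@form0_op0 _ _ dot
    (fun y => a y - (E A (a (E A y)) + E (~` A) (a (E (~` A) y))))).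
    move=> k u v; rewrite !(spectral_linear mA) !(spectral_linear mAC) !al.
    rewrite !(spectral_linear mA) !(spectral_linear mAC).
    by rewrite [X in _ - X]addrACA -scalerDr opprD addrACA -scalerBr.
  move=> {}y; rewrite dotBl dotDl !spectral_sa//.
  by rewrite -spectral_form_split// subrr.
have E0 y : E A (E (~` A) y) = 0 by rewrite spectral_interE// setICr spectral_set0.
have E0' y : E (~` A) (E A y) = 0.
  by rewrite spectral_interE// setIC setICr spectral_set0.
rewrite [RHS](congr1 (E A) (split0 x)) [LHS]split0.
rewrite (linearD_op _ _ (spectral_linear mA)) E0 addr0 !spectral_idem//.
by rewrite E0' linear0_op// linear0_op ?addr0//; exact: spectral_linear.
Qed.

(** Intersecting A with an interval that carries E makes the identity function
    integrable; the form bounds below follow by monotonicity. *)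
Lemma spectral_form_Rintegral A x : measurable A -> E A x = x ->
  exists (mu : {finite_measure set (measurableTypeR R) -> \bar R}) A',
    [/\ measurable A', A' `<=` A,
        mu.-integrable A' (EFin \o (fun l : measurableTypeR R => l : R)),
        dot (a x) x = (\int[mu]_(l in A') (l : R))%R%:C
      & dot x x = (fine (mu A'))%:C].
Proof.
move=> mA Ax; have [r rE] := spectral_support.
have mI : measurable (`[- r, r]%classic : set (measurableTypeR R)).
  exact: measurable_itv.
have mAI : measurable (A `&` `[- r, r]%classic) by exact: measurableI.
have AIx : E (A `&` `[- r, r]%classic) x = x by rewrite -spectral_interE// rE.
have [mu x_mu] := spectral_measure_int aE x.
exists mu, (A `&` `[- r, r]%classic); split => //.
- exact: (@integrable_id_bounded _ _ _ (- r) r).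
- rewrite x_mu.2; congr (_%:C); apply: Rintegral_concentrated => //.
  exact: spectral_concentrated x_mu.
- by rewrite -x_mu.1// AIx.
Qed.

Lemma spectral_form_le A x (hi : R) : measurable A ->
  A `<=` [set l | l <= hi] -> E A x = x -> dot (a x) x <= hi%:C * dot x x.
Proof.
move=> mA Ahi /(spectral_form_Rintegral mA)[mu [A' [mA' A'A intA' -> ->]]].
rewrite -rmorphM/= lecR -Rintegral_cst//; apply: le_Rintegral => //.
- exact: (finite_measure_integrable_cst mu hi mA').
- by move=> l /A'A/Ahi.
Qed.

Lemma spectral_form_ge A x (lo : R) : measurable A ->
  A `<=` [set l | lo <= l] -> E A x = x -> lo%:C * dot x x <= dot (a x) x.
Proof.
move=> mA Alo /(spectral_form_Rintegral mA)[mu [A' [mA' A'A intA' -> ->]]].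
rewrite -rmorphM/= lecR -Rintegral_cst//; apply: le_Rintegral => //.
- exact: (finite_measure_integrable_cst mu lo mA').
- by move=> l /A'A/Alo.
Qed.

(** An operator d between E ]-oo, s[ and E ]-oo, s] is the sum of E ]-oo, s[
    and an operator with range in that of E {s}, on which a - s vanishes. So
    (a - s) d = (a - s) E ]-oo, s[, which is minus the negative part of a - s.
    Expressing that part through d shows later that it lies in M as soon as d
    does, although E takes its values a priori only in the bounded operators
    of H. *)
Lemma spectral_op_itv (s : R) d : linear d ->
  op_le dot (cst 0) d -> op_le dot d idfun ->
  op_le dot (E `]-oo, s[%classic) d -> op_le dot d (E `]-oo, s]%classic) ->
  let c := fun v => a v - s%:C *: v in
  (forall v, dot (c (d v)) v <= 0) /\ (forall v, 0 <= dot (c v - c (d v)) v).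
Proof.
move=> dl d0 d1 pd dq c.
set P : set (measurableTypeR R) := `]-oo, s[%classic in pd.
set Q : set (measurableTypeR R) := `]-oo, s]%classic in dq.
pose S : set (measurableTypeR R) := [set s].
have mP : measurable P by exact: measurable_itv.
have mQ : measurable Q by exact: measurable_itv.
have mS : measurable S by exact: measurable_set1.
have mPC := measurableC mP.
have cl : linear c.
  move=> k u v; rewrite /c al (scalerDr s%:C) opprD addrACA scalerBr.
  by rewrite !scalerA mulrC.
have cE A v : measurable A -> c (E A v) = E A (c v).
  move=> mA; have El := spectral_linear mA.
  by rewrite /c (linearB_op _ _ El) (linearZ_op _ _ El) spectral_commute.
have c_form A v : measurable A -> dot (c (E A v)) v =
    dot (a (E A v)) (E A v) - s%:C * dot (E A v) (E A v).
  move=> mA; rewrite -{1}spectral_idem// cE// spectral_sa//.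
  by rewrite /c dotBl dotZl.
have cS v : c (E S v) = 0.
  apply: (@form0_op0 _ _ dot (fun v => c (E S v))).
    by move=> k u w; rewrite spectral_linear// cl.
  move=> {}v; rewrite c_form//; apply/eqP; rewrite subr_eq0 eq_le; apply/andP.
  split; [apply: (spectral_form_le mS)|apply: (spectral_form_ge mS)].
  - by move=> l ->/=.
  - exact: spectral_idem.
  - by move=> l ->/=.
  - exact: spectral_idem.
have cd v : c (d v) = c (E P v).
  have [pdE qdE] := op_itv_projE dl d0 d1 (spectral_measure_proj aE mP)
    (spectral_measure_proj aE mQ) pd dq v.
  rewrite -qdE.
  have -> : Q = P `|` S.
    apply/seteqP; split=> l; rewrite /Q /P /S /= !in_itv/= le_eqVlt.
      by case/orP => [/eqP|]; [right|left].
    by case=> [->|->]; rewrite ?eqxx ?orbT.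
  rewrite spectralU// ?pdE; first by rewrite linearD_op// cS addr0.
  by apply/seteqP; split => // l [];
    rewrite /P /S /= in_itv/= => /[swap] ->; rewrite ltxx.
split=> v; rewrite cd.
  rewrite c_form// subr_le0; apply: (spectral_form_le mP).
    by move=> l; rewrite /P /= in_itv/= => /ltW.
  exact: spectral_idem.
rewrite -linearB_op// -spectralC// c_form// subr_ge0.
apply: (spectral_form_ge mPC); last exact: spectral_idem.
by move=> l; rewrite /P /= in_itv/= => /negP; rewrite -leNgt.
Qed.

End Spectral.

(** * From the spectral scale to commutation *)

Section Main.
Local Open Scope complex_scope.
Context {R : realType} {H : completeNormedModType R[i]}.
Variable dot : {dot H for (@Num.conj R[i])}.
Variables (n : nat) (b : 'I_n -> H -> H).
Implicit Types (t : 'rV[R]_n) (q : H -> H).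

Lemma op_comb_sum (I : finType) (k : I -> R) (t : I -> 'rV[R]_n) v :
  op_comb b (\sum_i k i *: t i) v = \sum_i (k i)%:C *: op_comb b (t i) v.
Proof.
rewrite /op_comb; under [RHS]eq_bigr do rewrite scaler_sumr.
rewrite exchange_big/=; apply: eq_bigr => j _.
rewrite summxE rmorph_sum scaler_suml; apply: eq_bigr => i _.
by rewrite mxE rmorphM scalerA.
Qed.

Lemma op_comb_delta j v : op_comb b (delta_mx 0 j) v = b j v.
Proof.
rewrite /op_comb (bigD1 j)//= big1 => [|i ij].
  by rewrite mxE !eqxx/= scale1r addr0.
by rewrite mxE eqxx/= (negbTE ij) scale0r.
Qed.

(** The t i form a basis of the n-dimensional space of row vectors, so each b j
    is a linear combination of the combinations given by the t i. *)
Lemma commute_basis q (t : 'I_n -> 'rV[R]_n) : linear q ->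
  free [seq t i | i : 'I_n] ->
  (forall i, op_comb b (t i) \o q = q \o op_comb b (t i)) ->
  forall j, b j \o q = q \o b j.
Proof.
move=> ql t_free tq j.
have t_basis : <<[seq t i | i : 'I_n]>>%VS = fullv.
  apply/eqP; rewrite eqEdim subvf dimvf/=.
  by rewrite (eqP t_free) size_map size_enum_ord /dim/= mul1n.
pose T : (#|'I_n|).-tuple 'rV[R]_n := [tuple of [seq t i | i : 'I_n]].
have jT : delta_mx 0 j \in <<T>>%VS by rewrite t_basis memvf.
have bE v : b j v = \sum_i (coord T i (delta_mx 0 j))%:C *:
    op_comb b (t (enum_val i)) v.
  rewrite -op_comb_delta {1}(coord_span jT) -op_comb_sum.
  by congr op_comb; apply: eq_bigr => i _; rewrite nth_image.
apply/funext => v /=; rewrite !bE.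
apply: (big_ind2 (fun x y => x = q y)) => [|x1 y1 x2 y2 -> ->|i _].
- by rewrite linear0_op.
- by rewrite linearD_op.
- rewrite linearZ_op//; congr (_ *: _).
  exact: (congr1 (fun f => f v) (tq (enum_val i))).
Qed.

Lemma op_comb_sa t : (forall i, self_adjoint dot (b i)) ->
  self_adjoint dot (op_comb b t).
Proof.
move=> b_sa x y; pose eq_form (u w : H) := dot u y = dot x w.
rewrite -/(eq_form _ _) /op_comb.
apply: (big_ind2 eq_form) => [|u1 w1 u2 w2 e1 e2|i _]; rewrite /eq_form.
- by rewrite dot0l dotC dot0l conjC0.
- by rewrite dotDl dotDr e1 e2.
- rewrite dotZl dotZr b_sa; congr (_ * _); apply/esym/CrealP.
  by rewrite complex_real.
Qed.

Variables (M : set (H -> H)) (tau : (H -> H) -> R[i]).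
Hypotheses (hM : von_neumann dot M) (tau_state : state dot M tau).
Hypotheses (tau_tracial : tracial M tau) (tau_faithful : faithful dot M tau).
Hypotheses (bM : forall i, M (b i)) (b_sa : forall i, self_adjoint dot (b i)).

(** With c the operator op_comb b t - s, the real part of the trace of c f is a
    linear function of Psi f, so it has the same value at q and d, and
    [proj_commute] applies with x = c d. *)
Lemma Psi_commute q (s : R) t (E : set (measurableTypeR R) -> H -> H) d :
  M q -> projection dot q ->
  spectral_measure dot (op_comb b t) E ->
  op_itv dot M (E `]-oo, s[%classic) (E `]-oo, s]%classic) d ->
  Psi tau b q = Psi tau b d ->
  op_comb b t \o q = q \o op_comb b t.
Proof.
move=> Mq q_proj bE [[Md d0 d1] pd dq] /eq_row_mx[tau_qd tau_bqd].
have [[ql _] qq q_sa] := q_proj.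
have tau0E : complex.Re (tau q) = complex.Re (tau d).
  by move/rowP/(_ ord0): tau_qd; rewrite !mxE.
have taubE i : complex.Re (tau (b i \o q)) = complex.Re (tau (b i \o d)).
  by move/rowP/(_ i): tau_bqd; rewrite !mxE.
have [Mbt _] := trace_sum hM tau_state (index_enum 'I_n) (fun i => (t ord0 i)%:C) bM.
rewrite -[fun v => _]/(op_comb b t) in Mbt.
have btl := vn_linear hM Mbt.
pose c := fun v => op_comb b t v - s%:C *: v.
have Mc : M c by exact: (vn_sub hM Mbt (vnZ hM s%:C (vn_id hM))).
have [cd_le0 ccd_ge0] := spectral_op_itv btl bE (vn_linear hM Md) d0 d1 pd dq.
have tau_c f : M f -> tau (c \o f) =
    \sum_i (t ord0 i)%:C * tau (b i \o f) - s%:C * tau f.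
  move=> Mf; have Mbf i : M (b i \o f) by exact: (vn_comp hM).
  have [Msum <-] := trace_sum hM tau_state (index_enum 'I_n)
    (fun i => (t ord0 i)%:C) Mbf.
  by rewrite -(traceZ hM tau_state _ Mf) -(traceB tau_state Msum (vnZ hM _ Mf)).
have ReZ (k : R) z : complex.Re (k%:C * z) = k * complex.Re z.
  by case: z => x y /=; rewrite mul0r subr0.
have cq : c \o q = q \o c.
  apply: (proj_commute hM tau_state tau_tracial tau_faithful Mc _
    (vn_comp hM Mc Md)) => //.
    move=> x y; rewrite /c dotBl dotBr dotZl dotZr op_comb_sa//.
    by congr (_ - _ * _); apply/esym/CrealP; rewrite complex_real.
  rewrite !tau_c// !raddfB/= !raddf_sum/= !ReZ tau0E; congr (_ - _).
  by apply: eq_bigr => i _; rewrite !ReZ taubE.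
apply/funext => v; have /(congr1 (fun f => f v)) := cq.
rewrite /c /= (linearB_op _ _ ql) (linearZ_op _ _ ql).
exact: addIr.
Qed.

End Main.

(** * Central projections of a generated von Neumann algebra *)

Section VN.
Context {R : realType} {H : completeNormedModType R[i]}.
Variable dot : {dot H for (@Num.conj R[i])}.
Hypothesis hdot : hilbert_norm dot.
Implicit Types (S : set (H -> H)) (q : H -> H).

Lemma vn_generated_id S :
  vn_generated dot (S `|` [set idfun]) = vn_generated dot S.
Proof.
apply/seteqP; split=> a aS A [A_vn SA]; apply: aS; split=> //.
  by move=> c [/SA//|->]; exact: (vn_id A_vn).
by move=> c Sc; apply: SA; left.
Qed.

(** The commutant of q is itself a von Neumann algebra containing S, so it
    contains the algebra generated by S. *)
Lemma central_vn_generated S q : projection dot q -> S `<=` bounded_op ->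
  vn_generated dot S q -> (forall c, S c -> c \o q = q \o c) ->
  central_projection dot (vn_generated dot S) q.
Proof.
move=> q_proj Sb Sq Scomm; have [qb _ q_sa] := q_proj.
split=> //; split=> //; split=> // c Sc; apply/esym.
have q_vn : von_neumann dot (commutant [set q]).
  by apply: von_neumann_commutant => // d ->.
have [_ -> //] : commutant [set q] c; apply: Sc; split=> // d Sd.
by split; [exact: Sb|move=> e ->; exact: Scomm].
Qed.

End VN.

Theorem corollary4p7 (R : realType) (H : completeNormedModType R[i])
  (dot : {dot H for (@Num.conj R[i])}) (hdot : hilbert_norm dot)
  (M : set (H -> H)) (hM : finite_von_neumann dot M)
  (tau : (H -> H) -> R[i]) (tau_state : state dot M tau)
  (tau_tracial : tracial M tau) (tau_faithful : faithful dot M tau)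
  (tau_normal : normal dot M tau)
  (n : nat) (n_gt0 : (0 < n)%N) (b : 'I_n -> H -> H)
  (bM : forall i, M (b i)) (b_sa : forall i, self_adjoint dot (b i))
  (qm qp : H -> H)
  (qm_proj : projection dot qm) (qp_proj : projection dot qp)
  (qmN : vn_generated dot (range b `|` [set idfun]) qm)
  (qpN : vn_generated dot (range b `|` [set idfun]) qp)
  (qm_le_qp : op_le dot qm qp)
  (F_face : is_face (spectral_scale dot M tau b)
              (Psi tau b @` op_itv dot M qm qp))
  (s : 'I_n -> R) (t : 'I_n -> 'rV[R]_n) (t_neq0 : forall i, t i != 0)
  (E : 'I_n -> set (measurableTypeR R) -> H -> H)
  (hE : forall i, spectral_measure dot (op_comb b (t i)) (E i))
  (F_sub : forall i, Psi tau b @` op_itv dot M qm qp `<=`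
     Psi tau b @` op_itv dot M (E i `]-oo, s i[%classic) (E i `]-oo, s i]%classic))
  (t_free : free [seq t i | i : 'I_n]) :
  central_projection dot (vn_generated dot (range b)) qm /\
  central_projection dot (vn_generated dot (range b)) qp.
Proof.
have M_vn := hM.1.
have op_le_refl a : op_le dot a a by move=> x; rewrite subrr dot0l.
have itv q : projection dot q -> M q -> op_le dot qm q -> op_le dot q qp ->
    op_itv dot M qm qp q.
  move=> q_proj Mq mq qp_; have [[ql _] qq q_sa] := q_proj; split=> //; split=> //.
    apply/op_ge0P => x; have /(congr1 (fun f => f x))/= <- := qq.
    by rewrite q_sa; exact: dnorm_ge0.
  move=> x /=.
  have -> : dot (x - q x) x = dot (x - q x) (x - q x).
    rewrite [RHS]dotBr -q_sa linearB_op//.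
    by have /(congr1 (fun f => f x))/= -> := qq; rewrite subrr dot0l subr0.
  exact: dnorm_ge0.
have central q : projection dot q ->
    vn_generated dot (range b `|` [set idfun]) q ->
    op_le dot qm q -> op_le dot q qp ->
    central_projection dot (vn_generated dot (range b)) q.
  rewrite vn_generated_id => q_proj qN mq qp_.
  have [[ql _] _ _] := q_proj.
  have Mq : M q by apply: qN; split=> // _ [i _ <-].
  apply: central_vn_generated => //.
    by move=> _ [i _ <-]; exact: (vn_bounded M_vn (bM i)).
  move=> _ [j _ <-]; apply: (commute_basis ql t_free) => i.
  have [d d_itv dE] := F_sub i _ (imageP (Psi tau b) (itv q q_proj Mq mq qp_)).
  exact: (Psi_commute M_vn tau_state tau_tracial tau_faithful bM b_sa Mq q_proj
    (hE i) d_itv (esym dE)).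
by split; apply: central.
Qed.
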